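(* For each positive integer $M$ there are infinitely many real quadratic fields $K=\mathbb{Q}(\sqrt D)$ which do not admit $M$-ary totally positive integral universal (possibly non-classical) quadratic forms over $\mathcal{O}_K$.
   Context: For a totally real number field $K$ with ring of integers $\mathcal{O}_K$, an integral $M$-ary quadratic form over $\mathcal{O}_K$ is $Q(x_1,\dots,x_M)=\sum_{1\le i\le j\le M} a_{ij}x_ix_j$ with all $a_{ij}\in\mathcal{O}_K$ (no parity condition on the cross coefficients $a_{ij}$, $i\neq j$, is imposed; ''classical'' would mean the cross coefficients are even). $Q$ is totally positive (definite) if for every real embedding $\sigma$ of $K$ the real form $\sum \sigma(a_{ij})x_ix_j$ is positive definite. An element $a\in K$ is totally positive if $\sigma(a)>0$ for all real embeddings $\sigma$. $Q$ is universal if every totally positive $a\in\mathcal{O}_K$ equals $Q(x_1,\dots,x_M)$ for some $x_1,\dots,x_M\in\mathcal{O}_K$. *)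

(* Defs.v *)
From HB Require Import structures.
From mathcomp Require Import all_boot all_order all_algebra all_field.
From mathcomp Require Import reals.

Set Implicit Arguments.
Unset Strict Implicit.
Unset Printing Implicit Defensive.

Import Order.TTheory GRing.Theory Num.Theory.
Local Open Scope ring_scope.

Definition squarefree (D : nat) : Prop :=
  forall d : nat, (d ^ 2 %| D)%N -> d = 1%N.

Definition real_quadratic_field (K : fieldExtType rat) : Prop :=
  exists D : nat, (1 < D)%N /\ squarefree D /\
    exists s : K, s ^+ 2 = D%:R /\ <<1; s>>%VS = {:K}%VS.

Definition isomorphic_fields (K L : fieldExtType rat) : Prop :=
  exists f : {rmorphism K -> L}, bijective f.

Definition in_ring_of_integers (K : fieldExtType rat) (x : K) : Prop :=
  integralOver (intr : int -> K) x.

(* For R : realType, the ring morphisms K -> R are the real embeddings of K. *)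
Definition totally_positive (R : realType) (K : fieldExtType rat) (x : K) :
    Prop :=
  forall sigma : {rmorphism K -> R}, 0 < sigma x.

(* An M-ary quadratic form is given by the upper triangle i <= j of a matrix of
   coefficients; the entries strictly below the diagonal are ignored. *)
Definition qform_eval (F : comNzRingType) (M : nat) (a : 'M[F]_M)
    (x : 'rV[F]_M) : F :=
  \sum_(i < M) \sum_(j < M | (i <= j)%N) a i j * x 0 i * x 0 j.

Definition integral_form (K : fieldExtType rat) (M : nat) (a : 'M[K]_M) :
    Prop :=
  forall i j : 'I_M, (i <= j)%N -> in_ring_of_integers (a i j).

Definition totally_positive_form (R : realType) (K : fieldExtType rat)
    (M : nat) (a : 'M[K]_M) : Prop :=
  forall (sigma : {rmorphism K -> R}) (v : 'rV[R]_M),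
    v != 0 -> 0 < qform_eval (map_mx sigma a) v.

Definition universal_form (R : realType) (K : fieldExtType rat)
    (M : nat) (a : 'M[K]_M) : Prop :=
  forall c : K, in_ring_of_integers c -> totally_positive R c ->
    exists x : 'rV[K]_M,
      (forall i, in_ring_of_integers (x 0 i)) /\ qform_eval a x = c.

Definition admits_universal_form (R : realType) (K : fieldExtType rat)
    (M : nat) : Prop :=
  exists a : 'M[K]_M,
    integral_form a /\ totally_positive_form R a /\ universal_form R a.

(* Main.v *)
Require Import Defs.
From HB Require Import structures.
From mathcomp Require Import all_boot all_order all_algebra all_field.
From mathcomp Require Import reals.
From mathcomp Require Import boolp ring lra zify.

Set Implicit Arguments.
Unset Strict Implicit.
Unset Printing Implicit Defensive.

Import Order.TTheory GRing.Theory Num.Theory.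
Local Open Scope ring_scope.

(** If [d] is squarefree, [d = 2] modulo 4 and [f^2 d = k^2 + 1], then
    [delta = (k + f s) / (2 s)], where [s^2 = d], is a totally positive element
    of the codifferent of [Q(s)], and the totally positive integers
    [(s + t) (f s - k)] with [0 <= t < sqrt d] all satisfy
    [Tr (delta x) = 1]. For a totally positive integral form [Q] in [M]
    variables, [Tr (delta Q)] is a positive definite integer-valued form of
    rank [2 M] over [Z]. If two vectors of value 1 are congruent modulo 2, then
    half their sum and half their difference have values adding up to 1, so one
    of these vanishes and the vectors are equal up to sign. Hence [Q] represents
    at most [4^M] elements [x] with [Tr (delta x) = 1], and is not universal
    once [d > 16^M]. Such [d] are the squarefree parts of [k^2 + 1] for odd [k],
    and they are unbounded because a large prime [p] can be made to divide
    [k^2 + 1] exactly once. *)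

(** * Squarefree parts of [k ^ 2 + 1] *)

Lemma squarefree_part (n : nat) : (0 < n)%N ->
  exists f d : nat, n = (f ^ 2 * d)%N /\ squarefree d.
Proof.
elim/ltn_ind: n => n IHn n_gt0.
have [sf|] := pselect (squarefree n); first by exists 1%N, n; rewrite mul1n.
move=> /existsNP [e /not_implyP [/dvdnP [m def_n] e_neq1]].
have e_gt1 : (1 < e)%N.
  by case: e def_n e_neq1 n_gt0 => [|[|e]] //= ->; rewrite muln0.
have m_gt0 : (0 < m)%N by move: n_gt0; rewrite def_n; case: (m).
have [|f [d [def_m sf]]] := IHn m _ m_gt0.
  by rewrite def_n ltn_Pmulr // (@ltn_exp2r 1 e 2).
exists (f * e)%N, d; split=> //.
by rewrite def_n def_m expnMn; lia.
Qed.

Lemma squarefree_gt0 (d : nat) : squarefree d -> (0 < d)%N.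
Proof. by case: d => // /(_ 0%N (dvdn0 _)). Qed.

Lemma squarefree_logn (d p : nat) :
  squarefree d -> prime p -> (p %| d)%N -> logn p d = 1%N.
Proof.
move=> sf p_pr p_dvd; have d_gt0 := squarefree_gt0 sf.
apply/eqP; rewrite eqn_leq -[(0 < _)%N]pfactor_dvdn // expn1 p_dvd andbT leqNgt.
apply/negP; rewrite -pfactor_dvdn // => /sf p1.
by rewrite p1 in p_pr.
Qed.

(* Both [m + p] and [m + 3 p] solve [k ^ 2 = -1] modulo [p]; they cannot both
   solve it modulo [p ^ 2]. *)
Lemma exists_odd_sqr_add1_exact (B : nat) : exists p k : nat,
  [/\ prime p, (B < p)%N, odd k, (p %| k ^ 2 + 1)%N & ~~ (p ^ 2 %| k ^ 2 + 1)%N].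
Proof.
(* A prime factor [p] of [m ^ 2 + 1] cannot divide the factorial [m], so it exceeds [B.+2]. As [m]
   is even and [p] odd, [m + p] and [m + 3 * p] are both odd. *)
pose m := (B.+2)`!; pose p := pdiv (m ^ 2 + 1).
have m_gt0 : (0 < m)%N by exact: fact_gt0.
have p_pr : prime p by apply: pdiv_prime; rewrite addn1 ltnS expn_gt0 m_gt0.
have p_dvd : (p %| m ^ 2 + 1)%N by exact: pdiv_dvd.
have pNm : ~~ (p %| m)%N.
  apply/negP=> pm; move: p_dvd; rewrite dvdn_addr ?dvdn1; last first.
    by rewrite expnS dvdn_mulr.
  by move/eqP=> p1; rewrite p1 in p_pr.
have B_lt_p : (B.+2 < p)%N.
  rewrite ltnNge; apply: contra pNm => pB.
  by apply: dvdn_fact; rewrite pB prime_gt0.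
have m_even : ~~ odd m.
  by rewrite -dvdn2; apply: dvdn_fact.
clearbody p m.
have p_odd : odd p by have [p2|//] := even_prime p_pr; rewrite p2 in B_lt_p.
have dvd1 : (p %| (m + p) ^ 2 + 1)%N.
  have -> : ((m + p) ^ 2 + 1 = (m ^ 2 + 1) + p * (2 * m + p))%N by nia.
  by rewrite dvdn_add // dvdn_mulr.
have dvd3 : (p %| (m + 3 * p) ^ 2 + 1)%N.
  have -> : ((m + 3 * p) ^ 2 + 1 = (m ^ 2 + 1) + p * (6 * m + 9 * p))%N by nia.
  by rewrite dvdn_add // dvdn_mulr.
have [sq1|] := boolP (p ^ 2 %| (m + p) ^ 2 + 1)%N; last first.
  move=> Nsq1; exists p, (m + p)%N; split=> //; first by lia.
  by rewrite oddD p_odd (negbTE m_even).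
have [sq3|] := boolP (p ^ 2 %| (m + 3 * p) ^ 2 + 1)%N; last first.
  move=> Nsq3; exists p, (m + 3 * p)%N; split=> //; first by lia.
  by rewrite oddD oddM p_odd (negbTE m_even).
(* The two values differ by [4 * m * p + 8 * p ^ 2]; hence [p] would divide [4 * m], although it is
   odd and does not divide [m]. *)
have : (p ^ 2 %| p * (4 * m))%N.
  rewrite -(@dvdn_addr (8 * p ^ 2)); last exact: dvdn_mull.
  rewrite -(dvdn_addr _ sq1).
  suff -> : ((m + p) ^ 2 + 1 + (8 * p ^ 2 + p * (4 * m))
             = (m + 3 * p) ^ 2 + 1)%N by [].
  by nia.
rewrite -mulnn dvdn_pmul2l ?prime_gt0 // Euclid_dvdM // (negbTE pNm) orbF.
rewrite (Euclid_dvdM 2 2) // orbb => /(@dvdn_leq p 2 isT) p_le2.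
by move: (leq_trans B_lt_p p_le2).
Qed.

(** For odd [k], [k ^ 2 + 1] is 2 modulo 4; this excludes an even [f] and gives [d] the same
    residue. A prime dividing [k ^ 2 + 1] exactly once cannot divide [f], so it divides [d]. *)
Lemma exists_large_discriminant (B : nat) : exists d : nat,
  [/\ squarefree d, (d %% 4 = 2)%N,
      exists f k : nat, (f ^ 2 * d = k ^ 2 + 1)%N
    & exists p, [/\ prime p, (B < p)%N & (p %| d)%N]].
Proof.
have [p [k [p_pr Bp k_odd p_dvd pN]]] := exists_odd_sqr_add1_exact B.
have [|f [d [def_k sf]]] := @squarefree_part (k ^ 2 + 1); first by rewrite addn1.
exists d; split=> //.
- have k4 : ((k ^ 2 + 1) %% 4 = 2)%N.
    rewrite -(odd_double_half k) k_odd -muln2.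
    have -> : ((1 + k./2 * 2) ^ 2 + 1 = (k./2 ^ 2 + k./2) * 4 + 2)%N by nia.
    by rewrite modnMDl.
  move: k4; rewrite def_k -(odd_double_half f) -muln2; case: (odd f).
    have -> : ((1 + f./2 * 2) ^ 2 * d = ((f./2 ^ 2 + f./2) * d) * 4 + d)%N by nia.
    by rewrite modnMDl.
  have -> : ((0 + f./2 * 2) ^ 2 * d = f./2 ^ 2 * d * 4)%N by nia.
  by rewrite modnMl.
- by exists f, k.
- exists p; split=> //.
  move: p_dvd pN; rewrite def_k Euclid_dvdM // Euclid_dvdX // andbT.
  by case/orP=> // pf; rewrite dvdn_mulr ?dvdn_exp2r.
Qed.

(** * Integrality and squares in the rationals *)

Lemma rat_integral_int (q : rat) :
  integralOver (intr : int -> rat) q -> q \is a Num.int.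
Proof.
case=> p p_mon p_root.
have q_int : (ratr q : algC) \in Aint.
  apply: (@root_monic_Aint (map_poly intr p)).
  - rewrite (_ : map_poly intr p = map_poly ratr (map_poly intr p)); last first.
      by rewrite -map_poly_comp; apply: eq_map_poly => z /=; rewrite ratr_int.
    by rewrite fmorph_root.
  - by rewrite monic_map.
  - by apply/polyOverP=> i; rewrite coef_map rpred_int.
have := Cint_rat_Aint (Crat_rat q) q_int.
by case/intrP=> z; rewrite -(ratr_int algC) => /fmorph_inj ->; rewrite intr_int.
Qed.

(** The squared denominator of [v] divides [numq v ^ 2 * d] and is coprime to [numq v], so it
    divides [d] and must be 1. *)
Lemma squarefree_mul_sqr_int (d : nat) (v : rat) :
  squarefree d -> v ^+ 2 * d%:R \is a Num.int -> v \is a Num.int.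
Proof.
move=> sf /intrP [m def_m].
have qv : v * (denq v)%:~R = (numq v)%:~R by rewrite numqE.
have : ((numq v) ^+ 2 * d = m * denq v ^+ 2 :> int).
  apply: (@intr_inj rat); rewrite [LHS]rmorphM [RHS]rmorphM !rmorphXn /= -qv -def_m.
  rewrite -[X in _ * X]pmulrn; ring.
move=> E; have : (`|denq v| ^ 2 %| `|numq v| ^ 2 * d)%N.
  by apply/dvdnP; exists `|m|%N; move: (congr1 absz E); rewrite !abszM -!mulnn.
rewrite Gauss_dvdr; last by rewrite coprimeXl // coprimeXr // coprime_sym coprime_num_den.
move/sf=> den1; rewrite Qint_def; apply/eqP.
by rewrite -absz_denq den1.
Qed.

(** Such a [v] would be an integer, and [p] would have an even exponent in [n]. *)
Lemma nat_not_sqr_rat (n p : nat) (v : rat) :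
  prime p -> logn p n = 1%N -> v ^+ 2 <> n%:R.
Proof.
move=> p_pr ln E.
have v_int : v \is a Num.int.
  apply: (@squarefree_mul_sqr_int 1 v); last by rewrite mulr1 E rpred_nat.
  by move=> e; rewrite dvdn1 => /eqP; case: e => [|[|e]].
case/intrP: v_int E => z -> E.
have : (`|z| ^ 2 = n)%N.
  rewrite -abszX; suff -> : z ^+ 2 = n :> int by [].
  by apply: (@intr_inj rat); rewrite rmorphXn /= E.
by move/(congr1 (logn p)); rewrite lognX ln; lia.
Qed.

(** * Coordinates and integers in a quadratic field *)

Definition rat_in (K : fieldExtType rat) : {rmorphism rat -> K} := in_alg K.
Arguments rat_in : simpl never.

Section QuadraticField.

Variables (K : fieldExtType rat) (d : nat) (s : K).
Hypothesis d_nsqr : forall v : rat, v ^+ 2 <> d%:R.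
Hypothesis s_sqr : s ^+ 2 = d%:R.
Hypothesis s_gen : <<1; s>>%VS = {:K}%VS.

Local Notation iQ := (rat_in K).

Lemma quad_coord_exists (x : K) :
  exists c : rat * rat, x == iQ c.1 + iQ c.2 * s.
Proof.
have : x \in <<1; s>>%VS by rewrite s_gen memvf.
case/Fadjoin_polyP=> p p_over ->.
elim/poly_ind: p p_over => [|p c IHp] p_over.
  by exists (0, 0); rewrite horner0 rmorph0 mul0r addr0.
have [i_over c_over] : p \is a polyOver 1%VS /\ c \in 1%VS.
  split; last first.
    by have /polyOverP/(_ 0) := p_over; rewrite coefD coefMX coefC add0r.
  apply/polyOverP=> i; have /polyOverP/(_ i.+1) := p_over.
  by rewrite coefD coefMX coefC addr0.
have [[a b] /= /eqP pE] := IHp i_over; have /vlineP [e ->] := c_over.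
exists (e + b * d%:R, a); rewrite hornerMXaddC pE /=.
rewrite -![_%:A]/(iQ _) rmorphD rmorphM rmorph_nat -s_sqr.
by apply/eqP; ring.
Qed.

Definition quad_coord (x : K) := xchoose (quad_coord_exists x).
Definition quad_re (x : K) : rat := (quad_coord x).1.
Definition quad_im (x : K) : rat := (quad_coord x).2.

Lemma quad_coordE (x : K) : x = iQ (quad_re x) + iQ (quad_im x) * s.
Proof. exact/eqP/(xchooseP (quad_coord_exists x)). Qed.

Lemma quad_coord_eq0 (a b : rat) : iQ a + iQ b * s = 0 -> a = 0 /\ b = 0.
Proof.
move=> ab0; have [b0|b_neq0] := eqVneq b 0.
  split=> //; apply: (fmorph_inj (rat_in K)); move: ab0.
  by rewrite b0 !rmorph0 mul0r addr0.
case: (@d_nsqr (a / b)); apply: (fmorph_inj (rat_in K)).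
rewrite rmorph_nat -s_sqr rmorphXn fmorph_div.
have ib_neq0 : iQ b != 0 by rewrite fmorph_eq0.
have -> : iQ a = - (iQ b * s) by apply/eqP; rewrite -addr_eq0 ab0.
by field.
Qed.

Lemma quad_coord_inj (a b a' b' : rat) :
  iQ a + iQ b * s = iQ a' + iQ b' * s -> a = a' /\ b = b'.
Proof.
move=> E; have [|/subr0_eq -> /subr0_eq ->] // := @quad_coord_eq0 (a - a') (b - b').
rewrite !rmorphB; transitivity ((iQ a + iQ b * s) - (iQ a' + iQ b' * s)).
  by ring.
by rewrite E subrr.
Qed.

Lemma quad_coordK (a b : rat) :
  quad_re (iQ a + iQ b * s) = a /\ quad_im (iQ a + iQ b * s) = b.
Proof. by have /quad_coord_inj [<- <-] := quad_coordE (iQ a + iQ b * s). Qed.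

Lemma quad_coordD (x y : K) :
  quad_re (x + y) = quad_re x + quad_re y /\
  quad_im (x + y) = quad_im x + quad_im y.
Proof.
apply: quad_coord_inj; rewrite -quad_coordE !rmorphD.
by rewrite {1}[x]quad_coordE {1}[y]quad_coordE; ring.
Qed.

Lemma quad_coordN (x : K) :
  quad_re (- x) = - quad_re x /\ quad_im (- x) = - quad_im x.
Proof.
apply: quad_coord_inj; rewrite -quad_coordE !rmorphN.
by rewrite {1}[x]quad_coordE; ring.
Qed.

Lemma quad_coordM (x y : K) :
  quad_re (x * y) = quad_re x * quad_re y + quad_im x * quad_im y * d%:R /\
  quad_im (x * y) = quad_re x * quad_im y + quad_im x * quad_re y.
Proof.
apply: quad_coord_inj; rewrite -quad_coordE !rmorphD !rmorphM rmorph_nat -s_sqr.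
by rewrite {1}[x]quad_coordE {1}[y]quad_coordE; ring.
Qed.

Lemma quad_coord_alg (a : rat) : quad_re (iQ a) = a /\ quad_im (iQ a) = 0.
Proof. by have := quad_coordK a 0; rewrite rmorph0 mul0r addr0. Qed.

(** Gives the two real embeddings when [r] is a real square root of [d], and the conjugation of [K]
    when [r = - s]. *)
Lemma quad_embedding (F : comNzRingType) (iF : {rmorphism rat -> F}) (r : F) :
  r ^+ 2 = d%:R -> exists f : {rmorphism K -> F},
    forall x, f x = iF (quad_re x) + iF (quad_im x) * r.
Proof.
move=> r_sqr; pose f x := iF (quad_re x) + iF (quad_im x) * r.
have fB : zmod_morphism f.
  move=> x y; rewrite /f; have [-> ->] := quad_coordD x (- y).
  by have [-> ->] := quad_coordN y; rewrite !rmorphB; ring.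
have fM : monoid_morphism f.
  split=> [|x y]; rewrite /f.
    have [] := quad_coord_alg 1; rewrite rmorph1 => -> ->.
    by rewrite rmorph1 rmorph0 mul0r addr0.
  have [-> ->] := quad_coordM x y.
  by rewrite !rmorphD !rmorphM rmorph_nat -r_sqr; ring.
pose fA := GRing.isZmodMorphism.Build K F f fB.
pose fR := GRing.isMonoidMorphism.Build K F f fM.
pose g : {rmorphism K -> F} := HB.pack f fA fR.
by exists g.
Qed.

Lemma integral_alg_int (q : rat) :
  in_ring_of_integers (iQ q) -> q \is a Num.int.
Proof.
case=> p p_mon p_root; apply: rat_integral_int; exists p => //.
rewrite -(fmorph_root iQ) -map_poly_comp.
rewrite (@eq_map_poly _ _ _ (intr : int -> K)) // => z /=.
by rewrite -[_%:A]/(iQ _) rmorph_int.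
Qed.

Hypothesis d_sf : squarefree d.
Hypothesis d_mod4 : (d %% 4 = 2)%N.

(** The trace [A = 2 u] and the norm [N] are integral. Since [(2 v) ^ 2 * d = A ^ 2 - 4 * N] and [d]
    is squarefree, [B = 2 v] is an integer too. *)
Lemma quad_coord_int (x : K) : in_ring_of_integers x ->
  quad_re x \is a Num.int /\ quad_im x \is a Num.int.
Proof.
move=> x_int.
have [|tau tauE] := @quad_embedding K iQ (- s); first by rewrite sqrrN.
set u := quad_re x; set v := quad_im x.
have tx_int : in_ring_of_integers (tau x).
  case: x_int => p p_mon p_root; exists p => //.
  rewrite (@eq_map_poly _ _ _ (tau \o intr)); last by move=> z /=; rewrite rmorph_int.
  by rewrite map_poly_comp fmorph_root.
have [A defA] : exists A : int, u + u = A%:~R.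
  apply/intrP/integral_alg_int.
  have <- : x + tau x = iQ (u + u).
    by rewrite tauE {1}[x]quad_coordE rmorphD /u /v; ring.
  exact: integral_add.
have [N defN] : exists N : int, u ^+ 2 - v ^+ 2 * d%:R = N%:~R.
  apply/intrP/integral_alg_int.
  have <- : x * tau x = iQ (u ^+ 2 - v ^+ 2 * d%:R).
    rewrite tauE {1}[x]quad_coordE rmorphB !rmorphM rmorph_nat -s_sqr /u /v.
    by ring.
  exact: integral_mul.
have [B defB] : exists B : int, v + v = B%:~R.
  apply/intrP/(squarefree_mul_sqr_int d_sf).
  have -> : (v + v) ^+ 2 * d%:R = (u + u) ^+ 2 - 4%:R * (u ^+ 2 - v ^+ 2 * d%:R) by ring.
  rewrite defA defN; apply: rpredB; first by rewrite rpredX ?intr_int.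
  by rewrite rpredM ?rpred_nat ?intr_int.
have E : A ^+ 2 - B ^+ 2 * d = 4 * N.
  apply: (@intr_inj rat).
  rewrite rmorphB !rmorphM /= -defA -defB -defN.
  rewrite -[d%:~R]pmulrn; ring.
(* As [d] is 2 modulo 4, [A ^ 2] is congruent to [2 * B ^ 2] modulo 4, which forces [A] and then [B]
   to be even. *)
have [A' A2] : exists A', A = 2 * A' by exists (A %/ 2)%Z; nia.
have [B' B2] : exists B', B = 2 * B' by exists (B %/ 2)%Z; nia.
have half (w : rat) (C : int) : w + w = (2 * C)%:~R -> w \is a Num.int.
  rewrite rmorphM /= => wE; suff -> : w = C%:~R by rewrite intr_int.
  by lra.
by split; [apply: (half _ A'); rewrite -A2 | apply: (half _ B'); rewrite -B2].
Qed.

End QuadraticField.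

(** * Existence and non-isomorphism of quadratic fields *)

Lemma quad_field_exists (d : nat) : (forall v : rat, v ^+ 2 <> d%:R) ->
  exists (K : fieldExtType rat) (s : K),
    s ^+ 2 = d%:R /\ <<1; s>>%VS = {:K}%VS.
Proof.
move=> d_nsqr; pose q : {poly rat} := 'X^2 - d%:R%:P.
have q_size : size q = 3%N by rewrite size_XnsubC.
have q_irr : irreducible_poly q.
  apply: cubic_irreducible; first by rewrite q_size.
  move=> v; rewrite rootE !hornerE subr_eq0; apply/eqP.
  exact: d_nsqr.
have [K _ [s s_root s_gen]] := irredp_FAdjoin q_irr.
exists K, s; split=> //; apply/eqP; rewrite -subr_eq0.
by move: s_root; rewrite rootE rmorphB /= map_polyXn map_polyC /= scaler_nat !hornerE.
Qed.

(** Write [f s = u + v t]. Squaring gives [u v = 0] and [d = u ^ 2 + v ^ 2 * e]: if [v = 0] then [d]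
    is a square, and if [u = 0] then [d * e] is the square of [v * e]. *)
Lemma quad_field_no_morphism (K L : fieldExtType rat) (d e : nat) (s : K) (t : L) :
  (forall v : rat, v ^+ 2 <> d%:R) -> (forall v : rat, v ^+ 2 <> e%:R) ->
  (forall v : rat, v ^+ 2 <> (d * e)%:R) ->
  s ^+ 2 = d%:R -> t ^+ 2 = e%:R -> <<1; t>>%VS = {:L}%VS ->
  {rmorphism K -> L} -> False.
Proof.
move=> d_nsqr e_nsqr de_nsqr s_sqr t_sqr t_gen f.
have fs_sqr : f s * f s = rat_in L d%:R by rewrite -expr2 -rmorphXn s_sqr !rmorph_nat.
have [re_sqr im_sqr] := quad_coordM e_nsqr t_sqr t_gen (f s) (f s).
rewrite fs_sqr in re_sqr im_sqr.
have [reE imE] := quad_coord_alg e_nsqr t_sqr t_gen d%:R.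
rewrite reE in re_sqr; rewrite imE in im_sqr => {reE imE fs_sqr}.
move: (quad_im _ _ _) (quad_re _ _ _) re_sqr im_sqr => v u uvE uv0.
have /eqP : u * v = 0 by lra.
rewrite mulf_eq0 => /orP [] /eqP w0.
  by apply: (de_nsqr (v * e%:R)); rewrite natrM uvE w0; ring.
by apply: (d_nsqr u); rewrite uvE w0; ring.
Qed.

(** * Quadratic forms and parity *)

Lemma qform_evalE (F : comNzRingType) (M : nat) (a : 'M[F]_M) (x : 'rV[F]_M) :
  qform_eval a x = \sum_(c : 'I_M * 'I_M | (c.1 <= c.2)%N) a c.1 c.2 * x 0 c.1 * x 0 c.2.
Proof. by rewrite /qform_eval pair_big_dep. Qed.

Lemma qform_parallelogram (F : comNzRingType) (M : nat) (a : 'M[F]_M)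
    (x y : 'rV[F]_M) :
  qform_eval a (x + y) + qform_eval a (x - y) =
  2 * (qform_eval a x + qform_eval a y).
Proof.
rewrite !qform_evalE -!big_split /= mulr_sumr; apply: eq_bigr => c _.
by rewrite !mxE; ring.
Qed.

Lemma qform_evalN (F : comNzRingType) (M : nat) (a : 'M[F]_M) (x : 'rV[F]_M) :
  qform_eval a (- x) = qform_eval a x.
Proof. by rewrite !qform_evalE; apply: eq_bigr => c _; rewrite !mxE; ring. Qed.

Lemma qform_eval_map (F G : comNzRingType) (f : {rmorphism F -> G}) (M : nat)
    (a : 'M[F]_M) (x : 'rV[F]_M) :
  f (qform_eval a x) = qform_eval (map_mx f a) (map_mx f x).
Proof.
rewrite !qform_evalE rmorph_sum; apply: eq_bigr => c _.
by rewrite !mxE !rmorphM.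
Qed.

Lemma integral_sum (A B : comNzRingType) (f : {rmorphism A -> B}) (I : Type)
    (r : seq I) (P : pred I) (F : I -> B) :
  (forall i, P i -> integralOver f (F i)) ->
  integralOver f (\sum_(i <- r | P i) F i).
Proof.
by move=> F_int; apply: big_ind => //; [exact: integral0 | move=> ? ?; exact: integral_add].
Qed.

Lemma qform_eval_integral (K : fieldExtType rat) (M : nat) (a : 'M[K]_M)
    (x : 'rV[K]_M) :
  integral_form a -> (forall i, in_ring_of_integers (x 0 i)) ->
  in_ring_of_integers (qform_eval a x).
Proof.
move=> a_int x_int; rewrite qform_evalE; apply: integral_sum => c c_le.
do 2!(apply: integral_mul; last exact: x_int).
exact: a_int.
Qed.

(** Meant for integral [q], whose numerator is [q] itself; taking a rational argument lets it apply
    directly to coordinates. *)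
Definition rat_parity (q : rat) : bool := odd `|numq q|.

Lemma rat_parity_eq (q r : rat) : q \is a Num.int -> r \is a Num.int ->
  rat_parity q = rat_parity r -> exists z : int, q = r + 2 * z%:~R.
Proof.
move=> /intrP [a ->] /intrP [b ->]; rewrite /rat_parity !numq_int => ab.
exists ((a - b) %/ 2)%Z.
have {1}-> : a = b + 2 * ((a - b) %/ 2)%Z by lia.
by rewrite rmorphD rmorphM.
Qed.

(** * The trace functional and the count modulo 2 *)

Section NoUniversalForm.

Variables (R : realType) (K : fieldExtType rat) (d f k : nat) (s : K).
Hypothesis d_nsqr : forall v : rat, v ^+ 2 <> d%:R.
Hypothesis s_sqr : s ^+ 2 = d%:R.
Hypothesis s_gen : <<1; s>>%VS = {:K}%VS.
Hypothesis d_sf : squarefree d.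
Hypothesis d_mod4 : (d %% 4 = 2)%N.
Hypothesis pell : (f ^ 2 * d = k ^ 2 + 1)%N.

Local Notation re := (quad_re s_sqr s_gen).
Local Notation im := (quad_im s_sqr s_gen).

(* [lam x] is the trace of [delta * x], for the totally positive element
   [delta = (k + f s) / (2 s)] of the codifferent. *)
Let lam (x : K) : rat := f%:R * re x + k%:R * im x.

(* These lie on the line [lam = 1], since [f s - k] has norm [-1]. *)
Let alpha (t : nat) : K := (s + t%:R) * (f%:R * s - k%:R).

Let lamD x y : lam (x + y) = lam x + lam y.
Proof.
by rewrite /lam; have [-> ->] := quad_coordD d_nsqr s_sqr s_gen x y; ring.
Qed.

Let lam_int x : in_ring_of_integers x -> lam x \is a Num.int.
Proof.
move/(quad_coord_int d_nsqr s_sqr s_gen d_sf d_mod4) => [re_int im_int].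
by rewrite rpredD // rpredM // rpred_nat.
Qed.

Let lam_gt0 x : totally_positive R x -> 0 < lam x.
Proof.
move=> x_pos; pose r : R := Num.sqrt d%:R.
have r_sqr : r ^+ 2 = d%:R by rewrite sqr_sqrtr.
have [sp spE] := @quad_embedding K d s d_nsqr s_sqr s_gen R ratr r r_sqr.
have [sm smE] := @quad_embedding K d s d_nsqr s_sqr s_gen R ratr (- r) (etrans (sqrrN r) r_sqr).
have xp : 0 < ratr (re x) + ratr (im x) * r by have := x_pos sp; rewrite spE.
have xm : 0 < ratr (re x) - ratr (im x) * r by have := x_pos sm; rewrite smE mulrN.
rewrite -(ltr0q R) /lam raddfD /= !rmorphM /= !ratr_nat.
move: (ratr (im x)) (ratr (re x)) xm xp => v u xm xp.
have r_ge0 : 0 <= r by exact: sqrtr_ge0.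
(* This amounts to the positivity of [delta] at the embedding sending [s] to [- r]. *)
have fr_gt : k%:R < f%:R * r.
  rewrite -(@ltr_pXn2r _ 2) ?nnegrE ?mulr_ge0 // exprMn r_sqr.
  by rewrite -!natrX -natrM pell ltr_nat addn1.
have f_gt0 : 0 < f%:R :> R.
  by rewrite ltr0n lt0n; apply: contraTneq isT => f0; move: pell; rewrite f0; lia.
have k_ge0 : 0 <= k%:R :> R by [].
have u_gt0 : 0 < u by lra.
(* For [v < 0], [f * u + k * v] is [f * (u + v * r)] plus the positive term [(k - f * r) * v]. *)
have [v_ge0|v_lt0] := leP 0 v; first by nra.
have : 0 < f%:R * (u + v * r) by exact: mulr_gt0.
by nra.
Qed.

Let alpha_lam t : lam (alpha t) = 1.
Proof.
have -> : alpha t = rat_in K (f%:R * d%:R - t%:R * k%:R)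
                    + rat_in K (t%:R * f%:R - k%:R) * s.
  by rewrite /alpha !rmorphB !rmorphM !rmorph_nat -s_sqr; ring.
rewrite /lam; have [-> ->] := quad_coordK d_nsqr s_sqr s_gen
  (f%:R * d%:R - t%:R * k%:R) (t%:R * f%:R - k%:R).
have : f%:R ^+ 2 * d%:R = k%:R ^+ 2 + 1 :> rat.
  by rewrite -!natrX -natrM pell natrD.
by lra.
Qed.

Let s_integral : in_ring_of_integers s.
Proof.
exists ('X^2 - d%:R%:P); first exact: monicXnsubC.
by rewrite rootE rmorphB /= map_polyXn map_polyC /= rmorph_nat !hornerE s_sqr subrr.
Qed.

Let alpha_integral t : in_ring_of_integers (alpha t).
Proof.
apply: integral_mul; first by apply: integral_add => //; exact: integral_nat.
apply: integral_sub; last exact: integral_nat.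
by apply: integral_mul => //; exact: integral_nat.
Qed.

(** At each embedding the two factors of [alpha t] have the same sign, namely that of the image [r]
    of [s], because [t < |r|] and [k < f * |r|]. *)
Let alpha_pos t : (t ^ 2 < d)%N -> totally_positive R (alpha t).
Proof.
move=> t_lt sigma; rewrite rmorphM rmorphB rmorphD rmorphM !rmorph_nat.
have : sigma s ^+ 2 = d%:R by rewrite -rmorphXn s_sqr rmorph_nat.
move: (sigma s) => r r_sqr.
have t_sqr : t%:R ^+ 2 < r ^+ 2 by rewrite r_sqr -natrX ltr_nat.
have fr_sqr : (f%:R * r) ^+ 2 = k%:R ^+ 2 + 1.
  by rewrite exprMn r_sqr -!natrX -natrM pell natrD.
have [f_ge0 k_ge0 t_ge0] : [/\ 0 <= f%:R :> R, 0 <= k%:R :> R & 0 <= t%:R :> R] by [].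
have [r_ge0|r_lt0] := leP 0 r.
  have tr : t%:R < r by rewrite -(@ltr_pXn2r _ 2) ?nnegrE.
  have kr : k%:R < f%:R * r.
    by rewrite -(@ltr_pXn2r _ 2) ?nnegrE ?mulr_ge0 // fr_sqr ltrDl.
  by apply: mulr_gt0; lra.
have tr : t%:R < - r by rewrite -(@ltr_pXn2r _ 2) ?nnegrE ?sqrrN //; lra.
have fr_le0 : f%:R * r <= 0 by rewrite mulr_ge0_le0 // ltW.
have fr_neq0 : f%:R * r != 0.
  by apply: contra_eq_neq fr_sqr => ->; rewrite expr0n /= lt_eqF // ltr_wpDl // sqr_ge0.
rewrite nmulr_rgt0; last by lra.
have : f%:R * r < 0 by rewrite lt_neqAle fr_neq0.
by lra.
Qed.

Let alpha_inj : injective alpha.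
Proof.
move=> t t' /mulIf tt; apply/eqP; rewrite -(eqr_nat rat); apply/eqP.
apply: (fmorph_inj (rat_in K)); rewrite !rmorph_nat; apply: (addrI s); apply: tt.
(* The common factor [f s - k] can be cancelled: were it 0, [alpha 0] would vanish and [lam 0] would
   be 1. *)
apply/eqP => fs_k; have := alpha_lam 0; rewrite /alpha fs_k mulr0 => lam0.
have := lamD 0 0; rewrite addr0 lam0; lra.
Qed.

Lemma quad_field_no_universal_form (M : nat) :
  ((4 ^ M) ^ 2 < d)%N -> ~ admits_universal_form R K M.
Proof.
move=> d_gt [a [a_int [a_pos a_univ]]].
(* One more value of [t] than there are parity classes; the largest is [4 ^ M], whose square is
   still below [d]. *)
have [|x xP] := @choice 'I_(4 ^ M).+1 'rV[K]_M (fun t x =>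
    (forall i, in_ring_of_integers (x 0 i)) /\ qform_eval a x = alpha t).
  move=> t; apply: a_univ; first exact: alpha_integral.
  by apply: alpha_pos; apply: leq_ltn_trans d_gt; rewrite leq_exp2r // -ltnS.
(* The class of [x t] modulo 2: two bits per entry, since integers of [K] have integral
   coordinates. *)
pose cls (t : 'I_(4 ^ M).+1) : {ffun 'I_M -> bool * bool} :=
  [ffun i => (rat_parity (re (x t 0 i)), rat_parity (im (x t 0 i)))].
have /injectivePn [t [t' tt' cls_eq]] : ~~ injectiveb cls.
  apply/negP=> /injectiveP /leq_card.
  by rewrite card_ord card_ffun card_prod card_bool card_ord ltnn.
have [xt_int xtE] := xP t; have [xt'_int xt'E] := xP t'.
have {cls_eq} [y yP] : exists y : 'rV[K]_M,
    (forall i, in_ring_of_integers (y 0 i)) /\ x t = x t' + y + y.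
  have [|y yP] := @choice 'I_M K (fun i z =>
      in_ring_of_integers z /\ x t 0 i = x t' 0 i + z + z).
    move=> i; have [re_int im_int] := quad_coord_int d_nsqr s_sqr s_gen d_sf d_mod4 (xt_int i).
    have [re'_int im'_int] := quad_coord_int d_nsqr s_sqr s_gen d_sf d_mod4 (xt'_int i).
    move/ffunP/(_ i): cls_eq; rewrite !ffunE => -[re_eq im_eq].
    have [m mE] := rat_parity_eq re_int re'_int re_eq.
    have [n nE] := rat_parity_eq im_int im'_int im_eq.
    exists (m%:~R + n%:~R * s); split.
      apply: integral_add; first exact: integral_id.
      by apply: integral_mul => //; exact: integral_id.
    rewrite (quad_coordE s_sqr s_gen (x t 0 i)) mE nE.
    rewrite {3}(quad_coordE s_sqr s_gen (x t' 0 i)).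
    by rewrite !rmorphD !rmorphM !rmorph_int rmorph_nat; ring.
  exists (\row_i y i); split=> [i|]; first by rewrite mxE; have [] := yP i.
  by apply/rowP=> i; rewrite !mxE; have [] := yP i.
(* Here [y] is half the difference and [z] half the sum of [x t] and [x t']. *)
case: yP => y_int xE; pose z : 'rV[K]_M := x t' + y.
have z_int i : in_ring_of_integers (z 0 i).
  by rewrite mxE; apply: integral_add; [exact: xt'_int | exact: y_int].
have lamQ (w : 'rV[K]_M) : (forall i, in_ring_of_integers (w 0 i)) -> w != 0 ->
    1 <= lam (qform_eval a w).
  move=> w_int w_neq0.
  have := lam_int (qform_eval_integral a_int w_int).
  have : 0 < lam (qform_eval a w).
    apply: lam_gt0 => sigma; rewrite qform_eval_map; apply: a_pos.
    apply: contraNneq w_neq0 => w0; apply/eqP/rowP=> i; rewrite mxE.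
    by apply: (fmorph_inj sigma); move/rowP/(_ i): w0; rewrite !mxE rmorph0.
  move=> lam_pos /intrP [n nE]; move: lam_pos; rewrite nE ltr0z ler1z; lia.
(* By the parallelogram law, twice this sum is [lam (alpha t) + lam (alpha t') = 2]. *)
have lam_eq : lam (qform_eval a z) + lam (qform_eval a y) = 1.
  have /(congr1 lam) := qform_parallelogram a z y.
  rewrite -/z {1}/z -xE {1}/z addrK xtE xt'E mulrDl mul1r !lamD !alpha_lam; lra.
have [y0|/(lamQ y y_int) y_ge1] := eqVneq y 0.
  case/negP: tt'; apply/eqP/val_inj/alpha_inj.
  by rewrite -xtE -xt'E xE y0 !addr0.
have [z0|/(lamQ z z_int) z_ge1] := eqVneq z 0; last first.
  by have := lerD z_ge1 y_ge1; rewrite lam_eq gerDl ler10.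
(* With [z = 0] the vectors [x t] and [x t'] are opposite, so the form takes the same value on
   both. *)
case/negP: tt'; apply/eqP/val_inj/alpha_inj.
rewrite -xtE -xt'E xE -/z z0 add0r -qform_evalN; congr qform_eval.
by apply/eqP; rewrite eq_sym -addr_eq0 -z0.
Qed.

End NoUniversalForm.

Theorem theorem1 (R : realType) (M : nat) (hM : (0 < M)%N) :
  exists K : nat -> fieldExtType rat,
    (forall n : nat, real_quadratic_field (K n)) /\
    (forall m n : nat, m <> n -> ~ isomorphic_fields (K m) (K n)) /\
    (forall n : nat, ~ admits_universal_form R (K n) M).
Proof.
have [g gP] := choice exists_large_discriminant.
(* Each [d n.+1] has a prime factor exceeding [d n]. Starting at [n.+1] iterations makes [d 0]
   already an output of [g]. *)
pose B := ((4 ^ M) ^ 2)%N; pose d n := iter n.+1 g B.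
have d_ltn n : (d n < d n.+1)%N.
  have [sf _ _ [p [_ d_lt_p p_dvd]]] := gP (d n).
  by apply: leq_trans d_lt_p (dvdn_leq _ p_dvd); apply: squarefree_gt0.
have d_leq m n : (m <= n)%N -> (d m <= d n)%N.
  elim: n => [|n IHn]; first by case: m.
  rewrite leq_eqVlt => /predU1P [->//|/IHn le_mn].
  exact: leq_trans le_mn (ltnW (d_ltn n)).
have d_gtB n : (B < d n)%N.
  apply: leq_trans (d_leq 0%N n isT).
  have [sf _ _ [p [_ B_lt_p p_dvd]]] := gP B.
  by apply: leq_trans B_lt_p (dvdn_leq _ p_dvd); apply: squarefree_gt0.
have d_gt1 n : (1 < d n)%N.
  by apply: leq_ltn_trans (d_gtB n); rewrite !expn_gt0.
have d_sf n : squarefree (d n) by have [] := gP (iter n g B).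
have d_nsqr n (v : rat) : v ^+ 2 <> (d n)%:R.
  apply: (@nat_not_sqr_rat _ (pdiv (d n))); first exact: pdiv_prime.
  by apply: squarefree_logn; rewrite ?pdiv_prime ?pdiv_dvd.
(* The prime factor of the later discriminant that exceeds its predecessor also exceeds [d m], so it
   has exponent 1 in the product. *)
have dd_nsqr m n (v : rat) : (m < n)%N -> v ^+ 2 <> (d m * d n)%:R.
  case: n => // n; rewrite ltnS => le_mn.
  have [_ _ _ [p [p_pr d_lt_p p_dvd]]] := gP (d n).
  apply: (@nat_not_sqr_rat _ p) => //.
  rewrite lognM ?(ltnW (d_gt1 _)) // (@squarefree_logn (d n.+1) p) //.
  rewrite lognE; case: and3P => // -[_ _ /dvdn_leq].
  by move=> /(_ (ltnW (d_gt1 _))); rewrite leqNgt (leq_ltn_trans (d_leq _ _ le_mn)).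
have [K KP] := choice (fun n => quad_field_exists (d_nsqr n)).
exists K; split=> [n|]; last split=> [m n mn [f _]|n].
- exists (d n); split; first exact: d_gt1.
  by split; [exact: d_sf | exact: KP].
- have [s [s_sqr _]] := KP m; have [t [t_sqr t_gen]] := KP n.
  apply: (quad_field_no_morphism (d_nsqr m) (d_nsqr n) _ s_sqr t_sqr t_gen f).
  move=> v; have [lt_mn|lt_nm|//] := ltngtP m n; first exact: dd_nsqr.
  by rewrite mulnC; apply: dd_nsqr.
- have [s [s_sqr s_gen]] := KP n.
  have [_ d_mod4 [f [k pell]] _] := gP (iter n g B).
  exact: quad_field_no_universal_form (d_nsqr n) s_sqr s_gen (d_sf n) d_mod4 pell _ (d_gtB n).
Qed.
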